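(* Let $\gamma(t)=\psi(u(t),v(t))$ be a smooth regular curve in $\mathbb{H}^2(r)$ and let $P^2$ be one of the three reference planes $\mathrm{span}\{\mathbf{e}_x,\mathbf{e}_y\}$ (elliptic type, with $u>0$ along $\gamma$), $\mathrm{span}\{\mathbf{e}_y,\mathbf{e}_z\}$ (hyperbolic type), $\mathrm{span}\{\mathbf{e}_x+\mathbf{e}_y,\mathbf{e}_z\}$ (parabolic type). Then $\gamma$ is an extrinsic catenary with respect to $P^2$ if, and only if, its curvature $\kappa$ in $\mathbb{H}^2(r)$ satisfies $$\kappa(t)=-\frac{\langle\mathbf{n}(t),X(t)\rangle_1}{\mathrm{dist}(\gamma(t),P^2)},$$ where $X$ is the Killing field in $\mathbb{E}_1^4$ of the geodesics of $\mathbb{E}_1^4$ connecting $\gamma$ to a point of $P^2$, that is, the constant field $X=\mathbf{e}_z$ for the elliptic type, $X=-\mathbf{e}_x$ for the hyperbolic type, and $X=-\frac{1}{r\sqrt2}(\mathbf{e}_x+\mathbf{e}_y)$ for the parabolic type.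
   Context: $r>0$; $\mathbb{E}_1^4$ is $\mathbb{R}^4$ with coordinates $(x,y,z,w)$, canonical basis $\{\mathbf{e}_x,\mathbf{e}_y,\mathbf{e}_z,\mathbf{e}_w\}$ and $\langle X,Y\rangle_1=-X_0Y_0+X_1Y_1+X_2Y_2+X_3Y_3$. $\mathbb{H}^2(r)=\{(x,y,z,0):-x^2+y^2+z^2=-r^2,\ x>0\}$ with the induced metric, parametrized by $$\psi(u,v)=r\left(\cosh\tfrac{u}{r}\cosh\tfrac{v}{r},\ \cosh\tfrac{u}{r}\sinh\tfrac{v}{r},\ \sinh\tfrac{u}{r},\ 0\right),\quad (u,v)\in\mathbb{R}^2,$$ whose metric is $du^2+\cosh^2\frac{u}{r}\,dv^2$. The unit normal of $\gamma$ in $\mathbb{H}^2(r)$ is $\mathbf{n}=\frac{1}{\|\dot\gamma\|}\left(-\dot v\cosh\frac{u}{r}\,\partial_u+\frac{\dot u}{\cosh\frac{u}{r}}\,\partial_v\right)$ with $\partial_u=\psi_u,\ \partial_v=\psi_v$, viewed as a vector of $\mathbb{E}_1^4$. Curvature sign convention: $\kappa=-\langle\nabla_{\dot\gamma}\dot\gamma,\mathbf{n}\rangle/\|\dot\gamma\|^2$, with $\nabla$ the Levi-Civita connection of $\mathbb{H}^2(r)$. The distance from $\psi(u,v)$ to $P^2$ is taken as: $r\sinh\frac{u}{r}$ for $P^2=\mathrm{span}\{\mathbf{e}_x,\mathbf{e}_y\}$ and $u>0$; $r\cosh\frac{u}{r}\cosh\frac{v}{r}$ for $P^2=\mathrm{span}\{\mathbf{e}_y,\mathbf{e}_z\}$;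 $\frac{1}{\sqrt2}e^{-v/r}\cosh\frac{u}{r}$ for $P^2=\mathrm{span}\{\mathbf{e}_x+\mathbf{e}_y,\mathbf{e}_z\}$ (normalized up to a constant factor, matching the normalization of $X$). An extrinsic catenary with respect to $P^2$ is a critical point, on each compact subinterval $[a,b]$ of its domain and among smooth variations with fixed endpoints, of $\int_a^b\mathrm{dist}(\gamma(t),P^2)\|\dot\gamma(t)\|\,dt$, with $\gamma$ lying on one side of $P^2$. *)

(* Defs.v *)
(* Stdlib real numbers with Coquelicot. *)
From Stdlib Require Import Reals.
From Coquelicot Require Import Coquelicot.
Open Scope R_scope.

(** ** The ambient space E_1^4, with coordinates (x, y, z, w) *)

(* The vector space structure is Coquelicot's one on products. *)
Definition E4 : Type := (R * R * R * R)%type.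

Definition x_ (p : E4) : R := fst (fst (fst p)).
Definition y_ (p : E4) : R := snd (fst (fst p)).
Definition z_ (p : E4) : R := snd (fst p).
Definition w_ (p : E4) : R := snd p.

Definition e_x : E4 := (1, 0, 0, 0).
Definition e_y : E4 := (0, 1, 0, 0).
Definition e_z : E4 := (0, 0, 1, 0).

Definition lorentz (p q : E4) : R :=
  - (x_ p * x_ q) + y_ p * y_ q + z_ p * z_ q + w_ p * w_ q.

(* [Derive] is a total operator; it is only used below on smooth functions. *)
Definition DeriveE4 (c : R -> E4) (t : R) : E4 :=
  (Derive (fun s => x_ (c s)) t, Derive (fun s => y_ (c s)) t,
   Derive (fun s => z_ (c s)) t, Derive (fun s => w_ (c s)) t).

(** ** The hyperbolic plane H^2(r) in its global chart *)

Definition psi (r u v : R) : E4 :=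
  scal r ((cosh (u / r) * cosh (v / r), cosh (u / r) * sinh (v / r),
           sinh (u / r), 0) : E4).

Inductive chart_coord : Set := Cu | Cv.

Definition sum_coord (f : chart_coord -> R) : R := f Cu + f Cv.

Definition partial (i : chart_coord) (f : R -> R -> R) (u v : R) : R :=
  match i with
  | Cu => Derive (fun u' => f u' v) u
  | Cv => Derive (fun v' => f u v') v
  end.

Definition d_psi (r : R) (i : chart_coord) (u v : R) : E4 :=
  match i with
  | Cu => DeriveE4 (fun u' => psi r u' v) u
  | Cv => DeriveE4 (fun v' => psi r u v') v
  end.

(* The metric induced by [lorentz] in the chart [psi]; it is
   du^2 + cosh(u/r)^2 dv^2. *)
Definition metric (r : R) (i j : chart_coord) (u v : R) : R :=
  lorentz (d_psi r i u v) (d_psi r j u v).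

Definition metric_det (r u v : R) : R :=
  metric r Cu Cu u v * metric r Cv Cv u v
  - metric r Cu Cv u v * metric r Cv Cu u v.

Definition metric_inv (r : R) (i j : chart_coord) (u v : R) : R :=
  match i, j with
  | Cu, Cu => metric r Cv Cv u v / metric_det r u v
  | Cv, Cv => metric r Cu Cu u v / metric_det r u v
  | Cu, Cv => - metric r Cu Cv u v / metric_det r u v
  | Cv, Cu => - metric r Cv Cu u v / metric_det r u v
  end.

(* Christoffel symbol Gamma^k_ij of the Levi-Civita connection of H^2(r). *)
Definition christoffel (r : R) (k i j : chart_coord) (u v : R) : R :=
  / 2 * sum_coord (fun l =>
    metric_inv r k l u v *
    (partial i (metric r j l) u v + partial j (metric r i l) u v
     - partial l (metric r i j) u v)).

(** ** Curves t |-> psi (u t, v t) in H^2(r) *)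

Definition curve (r : R) (u v : R -> R) (t : R) : E4 := psi r (u t) (v t).

Definition velocity (r : R) (u v : R -> R) (t : R) : E4 :=
  DeriveE4 (curve r u v) t.

Definition speed (r : R) (u v : R -> R) (t : R) : R :=
  sqrt (lorentz (velocity r u v t) (velocity r u v t)).

Definition coord_fun (u v : R -> R) (i : chart_coord) : R -> R :=
  match i with Cu => u | Cv => v end.

(* Component along [d_psi k] of the covariant derivative of the velocity
   along the curve. *)
Definition cov_accel_comp (r : R) (u v : R -> R) (k : chart_coord) (t : R) : R :=
  Derive_n (coord_fun u v k) 2 t +
  sum_coord (fun i => sum_coord (fun j =>
    christoffel r k i j (u t) (v t) *
    Derive (coord_fun u v i) t * Derive (coord_fun u v j) t)).

Definition cov_accel (r : R) (u v : R -> R) (t : R) : E4 :=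
  plus (scal (cov_accel_comp r u v Cu t) (d_psi r Cu (u t) (v t)))
       (scal (cov_accel_comp r u v Cv t) (d_psi r Cv (u t) (v t))).

Definition unit_normal (r : R) (u v : R -> R) (t : R) : E4 :=
  scal (/ speed r u v t)
    (plus (scal (- Derive v t * cosh (u t / r)) (d_psi r Cu (u t) (v t)))
          (scal (Derive u t / cosh (u t / r)) (d_psi r Cv (u t) (v t)))).

(* Note the minus sign in this convention. *)
Definition curvature (r : R) (u v : R -> R) (t : R) : R :=
  - lorentz (cov_accel r u v t) (unit_normal r u v t) / (speed r u v t) ^ 2.

(** ** Reference planes *)

Inductive ref_plane : Set :=
| Elliptic    (* span {e_x, e_y} *)
| Hyperbolic  (* span {e_y, e_z} *)
| Parabolic.  (* span {e_x + e_y, e_z} *)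

(* The planes lie in the hyperplane w = 0, which contains H^2(r), and split it
   into two half-spaces; every point of H^2(r) satisfies the last two
   conditions, whereas for p = psi (u, v) the first one means u > 0. *)
Definition on_side (P : ref_plane) (p : E4) : Prop :=
  match P with
  | Elliptic => 0 < z_ p
  | Hyperbolic => 0 < x_ p
  | Parabolic => 0 < x_ p - y_ p
  end.

(* Distance from psi (u, v) to the plane, meaningful when [on_side P (psi r u v)];
   in the parabolic case it is normalized by a constant factor, consistently
   with [killing]. *)
Definition dist_plane (r : R) (P : ref_plane) (u v : R) : R :=
  match P with
  | Elliptic => r * sinh (u / r)
  | Hyperbolic => r * cosh (u / r) * cosh (v / r)
  | Parabolic => / sqrt 2 * exp (- v / r) * cosh (u / r)
  end.

Definition killing (r : R) (P : ref_plane) : E4 :=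
  match P with
  | Elliptic => e_z
  | Hyperbolic => opp e_x
  | Parabolic => scal (- / (r * sqrt 2)) (plus e_x e_y)
  end.

(** ** Extrinsic catenaries *)

Definition in_itv (lo hi : Rbar) (t : R) : Prop := Rbar_lt lo t /\ Rbar_lt t hi.

Definition smooth_on (lo hi : Rbar) (f : R -> R) : Prop :=
  forall t, in_itv lo hi t -> forall n, ex_derive_n f n t.

(* Smoothness on an open neighbourhood of (-eps, eps) x [a, b], jointly in
   (s, t): [ex_diff_n f n] says that f has continuous partial derivatives up
   to order n. *)
Definition smooth_strip (eps del a b : R) (F : R -> R -> R) : Prop :=
  forall s t, - eps < s < eps -> a - del < t < b + del ->
  forall n, ex_diff_n F n s t.

(* (s, t) |-> psi (U s t, V s t), |s| < eps, is a smooth variation with fixed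
   endpoints of the curve psi (u, v) on [a, b], through curves on the same
   side of the plane. *)
Definition variation (r : R) (P : ref_plane) (u v : R -> R) (a b eps : R)
    (U V : R -> R -> R) : Prop :=
  0 < eps /\
  (exists del, 0 < del /\
     smooth_strip eps del a b U /\ smooth_strip eps del a b V) /\
  (forall t, a <= t <= b -> U 0 t = u t /\ V 0 t = v t) /\
  (forall s, - eps < s < eps ->
     U s a = u a /\ V s a = v a /\ U s b = u b /\ V s b = v b) /\
  (forall s t, - eps < s < eps -> a <= t <= b -> on_side P (curve r (U s) (V s) t)).

Definition energy (r : R) (P : ref_plane) (a b : R) (u v : R -> R) : R :=
  RInt (fun t => dist_plane r P (u t) (v t) * speed r u v t) a b.

Definition extrinsic_catenary (r : R) (P : ref_plane) (lo hi : Rbar)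
    (u v : R -> R) : Prop :=
  (forall t, in_itv lo hi t -> on_side P (curve r u v t)) /\
  forall a b, in_itv lo hi a -> in_itv lo hi b -> a < b ->
  forall (eps : R) (U V : R -> R -> R), variation r P u v a b eps U V ->
    is_derive (fun s => energy r P a b (U s) (V s)) 0 0.

(* Main.v *)
Require Import Defs.
From Stdlib Require Import Reals Lra Classical ClassicalEpsilon.
From Coquelicot Require Import Coquelicot.
Open Scope R_scope.

(* For each of the three planes the distance is the restriction to H^2(r) of the
   linear function <., X>, so its differential along the surface is <., X> too.
   The first variation of the energy with respect to a variation field
   (xi, eta) is therefore, after an integration by parts,
     int_a^b (<n, X> + dist * kappa) cosh(u/r) (u' eta - v' xi) dt,
   in which the last two factors measure the normal part of the field. Hence the
   curvature equation makes every variation critical. Conversely, where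
   <n, X> + dist * kappa = K is nonzero, the affine variation with
   (xi, eta) = K(t0) (- v'(t0), u'(t0)) (t - a)(b - t) on a small interval
   [a, b] around t0 has a positive first variation: being only required to vanish at
   the endpoints, it needs no bump function. *)

(** * Hyperbolic functions and the Lorentz product *)

Lemma is_derive_cosh (x : R) : is_derive cosh x (sinh x).
Proof. apply is_derive_Reals, derivable_pt_lim_cosh. Qed.

Lemma is_derive_sinh (x : R) : is_derive sinh x (cosh x).
Proof. apply is_derive_Reals, derivable_pt_lim_sinh. Qed.

Lemma ex_derive_cosh (x : R) : ex_derive cosh x.
Proof. eexists; apply is_derive_cosh. Qed.

Lemma ex_derive_sinh (x : R) : ex_derive sinh x.
Proof. eexists; apply is_derive_sinh. Qed.

Lemma cosh_gt_0 (x : R) : 0 < cosh x.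
Proof. unfold cosh; generalize (exp_pos x) (exp_pos (- x)); lra. Qed.

Lemma cosh2_sinh2 (x : R) : cosh x * cosh x - sinh x * sinh x = 1.
Proof.
  generalize (exp_plus x (- x)); rewrite Rplus_opp_r, exp_0.
  unfold cosh, sinh; lra.
Qed.

Lemma sinh_gt_0 (x : R) : 0 < x -> 0 < sinh x.
Proof.
  intros Hx; unfold sinh.
  generalize (exp_increasing (- x) x); lra.
Qed.

Lemma E4_eq (p q : E4) :
  x_ p = x_ q -> y_ p = y_ q -> z_ p = z_ q -> w_ p = w_ q -> p = q.
Proof.
  destruct p as [[[p0 p1] p2] p3], q as [[[q0 q1] q2] q3]; cbn.
  now intros -> -> -> ->.
Qed.

Lemma psi_eq (r u v : R) :
  psi r u v = (r * (cosh (u / r) * cosh (v / r)), r * (cosh (u / r) * sinh (v / r)),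
               r * sinh (u / r), 0).
Proof. apply E4_eq; cbn; try reflexivity. unfold mult; cbn; ring. Qed.

Lemma lorentz_scal (a : R) (p q : E4) : lorentz (scal a p) q = a * lorentz p q.
Proof. unfold lorentz; cbn; unfold mult; cbn; fold (x_ p) (y_ p) (z_ p) (w_ p); ring. Qed.

Lemma lorentz_plus (p p' q : E4) :
  lorentz (plus p p') q = lorentz p q + lorentz p' q.
Proof.
  unfold lorentz; cbn; unfold plus; cbn.
  fold (x_ p) (y_ p) (z_ p) (w_ p) (x_ p') (y_ p') (z_ p') (w_ p'); ring.
Qed.

Lemma lorentz_sym (p q : E4) : lorentz p q = lorentz q p.
Proof. unfold lorentz; ring. Qed.

Ltac derive_hyp :=
  apply is_derive_unique; auto_derive;
  [ repeat split; lra | unfold Rdiv; try field; lra ].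

(** * Metric and Christoffel symbols of the hyperbolic plane in its chart *)

Section Chart.
Variables (r : R) (hr : 0 < r).

Lemma d_psi_Cu (u v : R) :
  d_psi r Cu u v =
    (sinh (u / r) * cosh (v / r), sinh (u / r) * sinh (v / r), cosh (u / r), 0).
Proof.
  unfold d_psi, DeriveE4.
  apply E4_eq; cbn -[cosh sinh Derive]; unfold mult; cbn -[cosh sinh Derive]; derive_hyp.
Qed.

Lemma d_psi_Cv (u v : R) :
  d_psi r Cv u v = (cosh (u / r) * sinh (v / r), cosh (u / r) * cosh (v / r), 0, 0).
Proof.
  unfold d_psi, DeriveE4.
  apply E4_eq; cbn -[cosh sinh Derive]; unfold mult; cbn -[cosh sinh Derive]; derive_hyp.
Qed.

Lemma metric_uu (u v : R) : metric r Cu Cu u v = 1.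
Proof.
  unfold metric; rewrite d_psi_Cu; unfold lorentz; cbn -[cosh sinh].
  generalize (cosh2_sinh2 (u / r)) (cosh2_sinh2 (v / r)); intros h1 h2.
  (* Writing 1 as cosh^2 - sinh^2 in [u / r], with a second such factor in [v / r] on the sinh term,
     leaves a polynomial identity for [ring]. *)
  replace 1 with (cosh (u / r) * cosh (u / r) - sinh (u / r) * sinh (u / r) *
   (cosh (v / r) * cosh (v / r) - sinh (v / r) * sinh (v / r))) by (rewrite h2; lra).
  ring.
Qed.

Lemma metric_uv (u v : R) : metric r Cu Cv u v = 0.
Proof.
  unfold metric; rewrite d_psi_Cu, d_psi_Cv; unfold lorentz; cbn -[cosh sinh]; ring.
Qed.

Lemma metric_vu (u v : R) : metric r Cv Cu u v = 0.
Proof. unfold metric; rewrite lorentz_sym; apply metric_uv. Qed.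

Lemma metric_vv (u v : R) : metric r Cv Cv u v = cosh (u / r) ^ 2.
Proof.
  unfold metric; rewrite d_psi_Cv; unfold lorentz; cbn -[cosh sinh pow].
  generalize (cosh2_sinh2 (v / r)); intros h2.
  replace (cosh (u / r) ^ 2) with (cosh (u / r) ^ 2 *
   (cosh (v / r) * cosh (v / r) - sinh (v / r) * sinh (v / r))) by (rewrite h2; lra).
  ring.
Qed.

Lemma partial_u_cosh2 (u : R) :
  Derive (fun u' => cosh (u' / r) ^ 2) u = 2 * cosh (u / r) * sinh (u / r) / r.
Proof. derive_hyp. Qed.

Lemma partial_metric (i j k : chart_coord) (u v : R) :
  partial i (metric r j k) u v =
    match i, j, k with
    | Cu, Cv, Cv => 2 * cosh (u / r) * sinh (u / r) / r
    | _, _, _ => 0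
    end.
Proof.
  (* The formulas for the metric are pointwise equalities, so they pass under [Derive] only through
     extensionality. *)
  assert (H : forall f g : R -> R -> R, (forall u v, f u v = g u v) ->
      partial i f u v = partial i g u v).
  { intros f g Hfg; destruct i; apply Derive_ext; intros; apply Hfg. }
  destruct j, k;
  [ rewrite (H _ _ metric_uu) | rewrite (H _ _ metric_uv)
  | rewrite (H _ _ metric_vu) | rewrite (H _ _ metric_vv) ]; clear H;
  destruct i; unfold partial; (apply Derive_const || apply partial_u_cosh2).
Qed.

Lemma christoffel_eq (k i j : chart_coord) (u v : R) :
  christoffel r k i j u v =
    match k, i, j with
    | Cu, Cv, Cv => - (cosh (u / r) * sinh (u / r) / r)
    | Cv, Cu, Cv | Cv, Cv, Cu => sinh (u / r) / (r * cosh (u / r))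
    | _, _, _ => 0
    end.
Proof.
  unfold christoffel, sum_coord; rewrite !partial_metric.
  generalize (cosh_gt_0 (u / r)); intros hc.
  destruct k, i, j; unfold metric_inv, metric_det;
    rewrite ?metric_uu, ?metric_uv, ?metric_vu, ?metric_vv; field; lra.
Qed.
End Chart.

(** * The Lagrangian of the energy and its Euler-Lagrange expression *)

Definition height (r : R) (X : E4) (u v : R) : R := lorentz (psi r u v) X.
Definition d_height (r : R) (X : E4) (i : chart_coord) (u v : R) : R :=
  lorentz (d_psi r i u v) X.

Definition sqnorm (r u p q : R) : R := p ^ 2 + cosh (u / r) ^ 2 * q ^ 2.

(** With [X = killing r P] and [p], [q] the chart components of the velocity, this is the integrand
    of [energy]. Keeping [X] arbitrary treats the three planes at once. *)
Definition lagr (r : R) (X : E4) (u v p q : R) : R :=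
  height r X u v * sqrt (sqnorm r u p q).

Definition d_lagr (r : R) (X : E4) (u v p q du dv dp dq : R) : R :=
  (d_height r X Cu u v * du + d_height r X Cv u v * dv) * sqrt (sqnorm r u p q)
  + height r X u v *
    (p * dp + cosh (u / r) * sinh (u / r) / r * q ^ 2 * du
     + cosh (u / r) ^ 2 * q * dq) * / sqrt (sqnorm r u p q).

(* <n, X> + dist * kappa, in terms of the 2-jet of the curve. *)
Definition defect (r : R) (X : E4) (u v u1 v1 u2 v2 : R) : R :=
  (- v1 * cosh (u / r) * d_height r X Cu u v + u1 / cosh (u / r) * d_height r X Cv u v)
    * / sqrt (sqnorm r u u1 v1)
  + height r X u v * cosh (u / r) *
    (v1 * (u2 - cosh (u / r) * sinh (u / r) / r * v1 ^ 2)
     - u1 * (v2 + 2 * (sinh (u / r) / (r * cosh (u / r))) * u1 * v1))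
    * (/ sqrt (sqnorm r u u1 v1)) ^ 3.

Section Curve.
Variables (r : R) (hr : 0 < r).

Lemma velocity_eq (u v : R -> R) (t : R) : ex_derive u t -> ex_derive v t ->
  velocity r u v t = plus (scal (Derive u t) (d_psi r Cu (u t) (v t)))
                          (scal (Derive v t) (d_psi r Cv (u t) (v t))).
Proof.
  intros hu hv; rewrite d_psi_Cu, d_psi_Cv by assumption.
  unfold velocity, DeriveE4, curve.
  apply E4_eq; cbn -[cosh sinh Derive];
    unfold mult, plus; cbn -[cosh sinh Derive];
    apply is_derive_unique; auto_derive;
    try (repeat split; auto; lra);
    change (fun x => u x) with u; change (fun x => v x) with v;
    unfold Rdiv; try field; lra.
Qed.

Lemma lorentz_velocity (u v : R -> R) (t : R) : ex_derive u t -> ex_derive v t ->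
  lorentz (velocity r u v t) (velocity r u v t) =
  sqnorm r (u t) (Derive u t) (Derive v t).
Proof.
  intros hu hv; rewrite velocity_eq by assumption.
  rewrite !lorentz_plus, !lorentz_scal, !(lorentz_sym _ (plus _ _)),
    !lorentz_plus, !lorentz_scal.
  fold (metric r Cu Cu (u t) (v t)) (metric r Cu Cv (u t) (v t))
   (metric r Cv Cu (u t) (v t)) (metric r Cv Cv (u t) (v t)).
  rewrite metric_uu, metric_uv, metric_vu, metric_vv by assumption.
  unfold sqnorm; ring.
Qed.

Lemma speed_eq (u v : R -> R) (t : R) : ex_derive u t -> ex_derive v t ->
  speed r u v t = sqrt (sqnorm r (u t) (Derive u t) (Derive v t)).
Proof. intros; unfold speed; now rewrite lorentz_velocity. Qed.

Lemma sqnorm_gt_0 (u v : R -> R) (t : R) : ex_derive u t -> ex_derive v t ->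
  velocity r u v t <> zero -> 0 < sqnorm r (u t) (Derive u t) (Derive v t).
Proof.
  intros hu hv hne; generalize (cosh_gt_0 (u t / r)); intros hc.
  unfold sqnorm; generalize (pow_lt _ 2 hc); intros hc2.
  destruct (Req_dec (Derive u t) 0) as [h1|h1];
    [destruct (Req_dec (Derive v t) 0) as [h2|h2]|].
  (* With both chart components zero the velocity would be the zero vector, against regularity. *)
  - exfalso; apply hne; rewrite velocity_eq, h1, h2 by assumption.
    now rewrite !(scal_zero_l (K := R_AbsRing)), plus_zero_l.
  - generalize (Rmult_lt_0_compat _ _ hc2 (pow2_gt_0 _ h2)) (pow2_ge_0 (Derive u t)); lra.
  - generalize (Rmult_le_pos _ _ (Rlt_le _ _ hc2) (pow2_ge_0 (Derive v t)))
      (pow2_gt_0 _ h1); lra.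
Qed.

(** The frame [d_psi] is orthogonal, so with A, B the components of the covariant acceleration its
    product with the unit normal is cosh(u/r) (u' B - v' A) / speed. The minus sign in [curvature]
    turns this into the second summand of [defect]. *)
Lemma defect_eq (X : E4) (u v : R -> R) (t : R) : ex_derive u t -> ex_derive v t ->
  0 < sqnorm r (u t) (Derive u t) (Derive v t) ->
  lorentz (unit_normal r u v t) X + height r X (u t) (v t) * curvature r u v t =
  defect r X (u t) (v t) (Derive u t) (Derive v t) (Derive_n u 2 t) (Derive_n v 2 t).
Proof.
  intros hu hv hpos; unfold curvature, unit_normal, cov_accel.
  rewrite !lorentz_plus, !lorentz_scal, !(lorentz_sym _ (scal _ (plus _ _))),
    !lorentz_scal, !lorentz_plus, !lorentz_scal.
  fold (metric r Cu Cu (u t) (v t)) (metric r Cu Cv (u t) (v t))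
   (metric r Cv Cu (u t) (v t)) (metric r Cv Cv (u t) (v t)).
  rewrite metric_uu, metric_uv, metric_vu, metric_vv by assumption.
  unfold cov_accel_comp, sum_coord; rewrite !christoffel_eq by assumption.
  rewrite speed_eq by assumption; cbn [coord_fun].
  unfold defect; fold (d_height r X Cu (u t) (v t)) (d_height r X Cv (u t) (v t)).
  generalize (sqrt_lt_R0 _ hpos) (cosh_gt_0 (u t / r)); intros hs hc.
  field; repeat split; lra.
Qed.

Lemma is_derive_height (X : E4) (f g : R -> R) (s df dg : R) :
  is_derive f s df -> is_derive g s dg ->
  is_derive (fun s => height r X (f s) (g s)) s
    (d_height r X Cu (f s) (g s) * df + d_height r X Cv (f s) (g s) * dg).
Proof.
  intros hf hg; unfold d_height; rewrite d_psi_Cu, d_psi_Cv by assumption.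
  destruct X as [[[X0 X1] X2] X3].
  apply (is_derive_ext (fun s =>
    r * (cosh (f s / r) * (- cosh (g s / r) * X0 + sinh (g s / r) * X1)
         + sinh (f s / r) * X2))).
  { intros t; unfold height; rewrite psi_eq; unfold lorentz; cbn -[cosh sinh]; ring. }
  auto_derive.
  - repeat split; eexists; eassumption.
  - change (fun x => f x) with f; change (fun x => g x) with g.
    rewrite (is_derive_unique _ _ _ hf),
      (is_derive_unique _ _ _ hg).
    unfold lorentz; cbn -[cosh sinh]; unfold Rdiv; field; lra.
Qed.

Lemma is_derive_lagr (X : E4) (f g p q : R -> R) (s df dg dp dq : R) :
  is_derive f s df -> is_derive g s dg -> is_derive p s dp -> is_derive q s dq ->
  0 < sqnorm r (f s) (p s) (q s) ->
  is_derive (fun s => lagr r X (f s) (g s) (p s) (q s)) s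
    (d_lagr r X (f s) (g s) (p s) (q s) df dg dp dq).
Proof.
  intros hf hg hp hq hpos.
  assert (hsq : is_derive (fun s => sqrt (sqnorm r (f s) (p s) (q s))) s
    ((p s * dp + cosh (f s / r) * sinh (f s / r) / r * q s ^ 2 * df
     + cosh (f s / r) ^ 2 * q s * dq) * / sqrt (sqnorm r (f s) (p s) (q s)))).
  { generalize hpos; unfold sqnorm; intros hpos'; auto_derive.
    - repeat split; try (eexists; eassumption).
      ring_simplify; ring_simplify in hpos'; exact hpos'.
    - change (fun x => f x) with f; change (fun x => p x) with p;
        change (fun x => q x) with q.
      rewrite (is_derive_unique _ _ _ hf), (is_derive_unique _ _ _ hp),
        (is_derive_unique _ _ _ hq).
      generalize (sqrt_lt_R0 _ hpos'); intros hs; cbn [pow] in hs |- *.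
      unfold Rdiv in *; field; split; lra. }
  unfold lagr, d_lagr.
  evar_last.
  { exact (is_derive_mult _ _ _ _ _ (is_derive_height X f g s df dg hf hg) hsq
      Rmult_comm). }
  unfold plus, mult; cbn -[cosh sinh sqrt pow]; ring.
Qed.

(* The boundary term of the integration by parts in the first variation. *)
Definition momentum (X : E4) (u v p q xi eta : R) : R :=
  height r X u v * (p * xi + cosh (u / r) ^ 2 * q * eta) * / sqrt (sqnorm r u p q).

(** This is the Euler-Lagrange identity behind the integration by parts. The energy does not depend
    on the parametrization, so the Euler-Lagrange covector annihilates the velocity and is a
    multiple of [p eta - q xi]; multiplied by cosh(u/r), the latter is the speed times the normal
    component of the field. *)
Lemma is_derive_momentum (X : E4) (u v p q xi eta : R -> R)
    (t p' q' xi' eta' : R) :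
  is_derive u t (p t) -> is_derive v t (q t) ->
  is_derive p t p' -> is_derive q t q' ->
  is_derive xi t xi' -> is_derive eta t eta' ->
  0 < sqnorm r (u t) (p t) (q t) ->
  is_derive (fun t => momentum X (u t) (v t) (p t) (q t) (xi t) (eta t)) t
    (d_lagr r X (u t) (v t) (p t) (q t) (xi t) (eta t) xi' eta'
     - defect r X (u t) (v t) (p t) (q t) p' q' * cosh (u t / r)
       * (p t * eta t - q t * xi t)).
Proof.
  intros hu hv hp hq hxi heta hpos.
  set (h := fun t => height r X (u t) (v t)).
  assert (hh : is_derive h t (d_height r X Cu (u t) (v t) * p t
    + d_height r X Cv (u t) (v t) * q t)) by exact (is_derive_height X u v t _ _ hu hv).
  set (cu := fun t => cosh (u t / r)).
  assert (hcu : is_derive cu t (sinh (u t / r) / r * p t)).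
  { unfold cu; auto_derive.
    - eexists; eassumption.
    - change (fun x => u x) with u.
      rewrite (is_derive_unique _ _ _ hu); unfold Rdiv; field; lra. }
  (* Naming the height and the cosh factor as functions [h] and [cu] lets [auto_derive] treat them
     as atoms, whose derivatives are then supplied by [hh] and [hcu]. *)
  apply (is_derive_ext (fun t => h t * (p t * xi t + cu t ^ 2 * q t * eta t)
    * / sqrt (p t ^ 2 + cu t ^ 2 * q t ^ 2))); [reflexivity|].
  generalize hpos; unfold sqnorm; intros hpos'.
  generalize (sqrt_lt_R0 _ hpos'); intros hs.
  generalize (cosh_gt_0 (u t / r)); intros hc.
  generalize (sqrt_sqrt _ (Rlt_le _ _ hpos')); intros hss.
  auto_derive.
  - repeat split; try (eexists; eassumption).
    + cbn [pow] in hpos'; exact hpos'. 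
    + cbn [pow] in hs; unfold cu; lra.
  - change (fun x => h x) with h; change (fun x => p x) with p;
      change (fun x => q x) with q; change (fun x => cu x) with cu;
      change (fun x => xi x) with xi; change (fun x => eta x) with eta.
    rewrite (is_derive_unique _ _ _ hp), (is_derive_unique _ _ _ hq),
     (is_derive_unique _ _ _ hh), (is_derive_unique _ _ _ hcu),
     (is_derive_unique _ _ _ hxi), (is_derive_unique _ _ _ heta).
    unfold d_lagr, defect, sqnorm; fold (h t).
    change (cu t) with (cosh (u t / r)).
    cbn [pow] in hs, hss |- *.
    (* What remains is a rational identity in the jet of the curve, with the value of [S * S] as its
       only relation. *)
    generalize dependent (cosh (u t / r)); intros c; intros.
    generalize dependent (h t); intros H; intros.
    set (S := sqrt _) in *; clearbody S.
    field [hss]; repeat split; lra.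
Qed.
End Curve.

(** * Continuity over an arbitrary uniform space, for use both on the line and on the plane *)

Lemma continuous_Rinv_fun {T : UniformSpace} (f : T -> R) (z : T) :
  continuous f z -> f z <> 0 -> continuous (fun z => / f z) z.
Proof.
  intros hf h0; apply (continuous_comp f Rinv); [exact hf|].
  now apply continuous_Rinv.
Qed.

Lemma continuous_pow_fun {T : UniformSpace} (f : T -> R) (n : nat) (z : T) :
  continuous f z -> continuous (fun z => f z ^ n) z.
Proof.
  intros hf; induction n as [|n IHn]; cbn; [apply continuous_const|].
  now apply (continuous_mult (K := R_AbsRing)).
Qed.

Lemma continuous_cosh_fun {T : UniformSpace} (f : T -> R) (z : T) :
  continuous f z -> continuous (fun z => cosh (f z)) z.
Proof.
  intros hf; apply (continuous_comp f cosh); [exact hf|].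
  apply (ex_derive_continuous cosh), ex_derive_cosh.
Qed.

Lemma continuous_sinh_fun {T : UniformSpace} (f : T -> R) (z : T) :
  continuous f z -> continuous (fun z => sinh (f z)) z.
Proof.
  intros hf; apply (continuous_comp f sinh); [exact hf|].
  apply (ex_derive_continuous sinh), ex_derive_sinh.
Qed.

Lemma continuous_sqrt_fun {T : UniformSpace} (f : T -> R) (z : T) :
  continuous f z -> continuous (fun z => sqrt (f z)) z.
Proof.
  intros hf; apply (continuous_comp f sqrt); [exact hf | apply continuous_sqrt].
Qed.

Ltac solve_continuous :=
  repeat (assumption || lazymatch goal with
  | |- continuous (fun _ => ?c) _ => apply continuous_const
  | |- continuous (fun _ => _ + _) _ =>
      apply (continuous_plus (K := R_AbsRing) (V := R_NormedModule))
  | |- continuous (fun _ => _ - _) _ =>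
      apply (continuous_minus (K := R_AbsRing) (V := R_NormedModule))
  | |- continuous (fun _ => - _) _ =>
      apply (continuous_opp (K := R_AbsRing) (V := R_NormedModule))
  | |- continuous (fun _ => _ * _) _ => apply (continuous_mult (K := R_AbsRing))
  | |- continuous (fun _ => _ ^ _) _ => apply continuous_pow_fun
  | |- continuous (fun _ => cosh _) _ => apply continuous_cosh_fun
  | |- continuous (fun _ => sinh _) _ => apply continuous_sinh_fun
  | |- continuous (fun _ => sqrt _) _ => apply continuous_sqrt_fun
  | |- continuous (fun _ => / _) _ => apply continuous_Rinv_fun
  end).

Section Continuity.
Variables (r : R) (hr : 0 < r) (X : E4) (T : UniformSpace) (z : T).
Variables (f g p q : T -> R).
Hypotheses (hf : continuous f z) (hg : continuous g z).
Hypotheses (hp : continuous p z) (hq : continuous q z).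

Lemma continuous_height : continuous (fun z => height r X (f z) (g z)) z.
Proof using hf hg.
  destruct X as [[[X0 X1] X2] X3].
  apply (continuous_ext (fun z =>
    r * (cosh (f z / r) * (- cosh (g z / r) * X0 + sinh (g z / r) * X1)
         + sinh (f z / r) * X2))).
  { intros t; unfold height; rewrite psi_eq; unfold lorentz; cbn -[cosh sinh]; ring. }
  unfold Rdiv; solve_continuous.
Qed.

Lemma continuous_d_height (i : chart_coord) :
  continuous (fun z => d_height r X i (f z) (g z)) z.
Proof using hf hg hr.
  unfold d_height; destruct i;
  [eapply continuous_ext; [intros x; rewrite d_psi_Cu by assumption; reflexivity|]
  |eapply continuous_ext; [intros x; rewrite d_psi_Cv by assumption; reflexivity|]];
  unfold lorentz; cbn -[cosh sinh]; unfold Rdiv; solve_continuous.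
Qed.

Lemma continuous_sqnorm : continuous (fun z => sqnorm r (f z) (p z) (q z)) z.
Proof using hf hp hq. unfold sqnorm, Rdiv; solve_continuous. Qed.

Lemma continuous_lagr : continuous (fun z => lagr r X (f z) (g z) (p z) (q z)) z.
Proof using hf hg hp hq.
  generalize continuous_height, continuous_sqnorm; intros.
  unfold lagr; solve_continuous.
Qed.

Hypothesis hpos : 0 < sqnorm r (f z) (p z) (q z).

Lemma continuous_d_lagr (df dg dp dq : T -> R) :
  continuous df z -> continuous dg z -> continuous dp z -> continuous dq z ->
  continuous (fun z => d_lagr r X (f z) (g z) (p z) (q z) (df z) (dg z) (dp z) (dq z)) z.
Proof using hf hg hp hq hr hpos.
  generalize continuous_height, continuous_sqnorm, (continuous_d_height Cu),
    (continuous_d_height Cv), (sqrt_lt_R0 _ hpos); intros.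
  unfold d_lagr, Rdiv; solve_continuous; lra.
Qed.

Lemma continuous_defect (p' q' : T -> R) :
  continuous p' z -> continuous q' z ->
  continuous (fun z => defect r X (f z) (g z) (p z) (q z) (p' z) (q' z)) z.
Proof using hf hg hp hq hr hpos.
  generalize continuous_height, continuous_sqnorm, (continuous_d_height Cu),
    (continuous_d_height Cv), (sqrt_lt_R0 _ hpos), (cosh_gt_0 (f z * / r)); intros.
  unfold defect, Rdiv; solve_continuous; try lra.
  apply Rmult_integral_contrapositive; lra.
Qed.
End Continuity.

(** * The tube lemma and differentiation under the integral sign *)

Lemma continuity_2d_pt_continuous (f : R -> R -> R) (x y : R) :
  continuity_2d_pt f x y <->
  continuous (fun z : R * R => f (fst z) (snd z)) (x, y).
Proof. apply continuity_2d_pt_filterlim. Qed.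

Lemma continuity_2d_pt_snd (f : R -> R -> R) (x y : R) :
  continuity_2d_pt f x y -> continuous (f x) y.
Proof.
  intros hf; apply continuity_pt_filterlim; intros eps heps.
  destruct (hf (mkposreal eps heps)) as [d hd].
  exists d; split; [apply cond_pos|]; intros t [_ ht].
  apply hd; [rewrite Rminus_diag, Rabs_R0; apply cond_pos | exact ht].
Qed.

(** Tube lemma: the neighbourhoods of the points (x, t) contain a common strip around {x} x [a, b],
    by compactness of [a, b]. *)
Lemma locally_2d_compact (P : R -> R -> Prop) (x a b : R) :
  (forall t, a <= t <= b -> locally_2d P x t) ->
  locally x (fun s => forall t, a <= t <= b -> P s t).
Proof.
  intros H.
  assert (H' : forall t, exists d : posreal, a <= t <= b ->
    forall s t', Rabs (s - x) < d -> Rabs (t' - t) < d -> P s t').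
  { intros t; destruct (classic (a <= t <= b)) as [ht|ht].
    - destruct (H t ht) as [d hd]; now exists d.
    (* Off [a, b] the radius is a dummy value that makes [d] a gauge on the whole line. *)
    - exists (mkposreal 1 Rlt_0_1); tauto. }
  set (d t := proj1_sig (constructive_indefinite_description _ (H' t))).
  assert (hd := fun t => proj2_sig (constructive_indefinite_description _ (H' t))
    : a <= t <= b -> forall s t', Rabs (s - x) < d t -> Rabs (t' - t) < d t -> P s t').
  (* Each [t] in [a, b] lies within [d t'] of some [t'] in [a, b] with [e <= d t']; this comes under
     a double negation, removed by [NNPP]. *)
  destruct (compactness_value_1d a b d) as [e he].
  exists e; intros s hs t ht.
  destruct (NNPP _ (he t ht)) as (t' & ht' & h1 & h2).
  apply (hd t' ht'); [|exact h1].
  eapply Rlt_le_trans; [exact hs|exact h2].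
Qed.

(** The hypotheses are local at each point of {x} x [a, b]; the tube lemma provides the uniform
    neighbourhood of [x] required by [is_derive_RInt_param]. *)
Lemma is_derive_RInt_param_compact (f df : R -> R -> R) (x a b : R) : a <= b ->
  (forall t, a <= t <= b -> continuity_2d_pt df x t /\
     locally_2d (fun s t => is_derive (fun z => f z t) s (df s t)
                            /\ continuity_2d_pt f s t) x t) ->
  is_derive (fun s => RInt (f s) a b) x (RInt (df x) a b).
Proof.
  intros hab H.
  generalize (locally_2d_compact _ x a b (fun t ht => proj2 (H t ht))); intros Hx.
  replace (RInt (df x) a b) with (RInt (fun t => Derive (fun z => f z t) x) a b).
  - apply (is_derive_RInt_param f).
    + eapply filter_imp; [|exact Hx]; cbv beta; intros s hs t.
      rewrite Rmin_left, Rmax_right by assumption; intros ht.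
      eexists; apply (hs t ht).
    + rewrite Rmin_left, Rmax_right by assumption; intros t ht.
      destruct (H t ht) as [hc hl]; apply (continuity_2d_pt_ext_loc df); [|exact hc].
      destruct hl as [d hd]; exists d; intros s t' h1 h2; symmetry.
      apply is_derive_unique, hd; assumption.
    + eapply filter_imp; [|exact Hx]; cbv beta; intros s hs.
      apply (ex_RInt_continuous (V := R_CompleteNormedModule)).
      rewrite Rmin_left, Rmax_right by assumption; intros t ht.
      apply continuity_2d_pt_snd, hs, ht.
  - apply RInt_ext; rewrite Rmin_left, Rmax_right by assumption; intros t ht.
    apply is_derive_unique.
    apply (locally_singleton _ _ Hx); lra.
Qed.

Lemma ex_diff_2 (F : R -> R -> R) (s t : R) : ex_diff_n F 2 s t ->
  continuity_2d_pt F s t /\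
  ex_derive (fun s => F s t) s /\ ex_derive (F s) t /\
  continuity_2d_pt (fun s t => Derive (fun s => F s t) s) s t /\
  continuity_2d_pt (fun s t => Derive (F s) t) s t /\
  ex_derive (fun t => Derive (fun s => F s t) s) t /\
  ex_derive (fun s => Derive (F s) t) s /\
  ex_derive (Derive (F s)) t /\
  continuity_2d_pt (fun s t => Derive (fun s => Derive (F s) t) s) s t /\
  continuity_2d_pt (fun s t => Derive (fun t => Derive (fun s => F s t) s) t) s t /\
  continuity_2d_pt (fun s t => Derive_n (F s) 2 t) s t.
Proof.
  intros (c & es & et & (cs & ess & est & (css & _) & (cst & _))
    & (ct & ets & ett & (cts & _) & (ctt & _))).
  repeat split; assumption.
Qed.

Lemma locally_2d_strip (e1 e2 d1 d2 s t : R) : e1 < s < e2 -> d1 < t < d2 ->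
  locally_2d (fun s t => e1 < s < e2 /\ d1 < t < d2) s t.
Proof.
  intros hs ht.
  assert (h : 0 < Rmin (Rmin (s - e1) (e2 - s)) (Rmin (t - d1) (d2 - t))).
  { repeat apply Rmin_glb_lt; lra. }
  exists (mkposreal _ h); cbn; intros s' t' h1 h2.
  generalize (Rmin_l (Rmin (s - e1) (e2 - s)) (Rmin (t - d1) (d2 - t)))
    (Rmin_r (Rmin (s - e1) (e2 - s)) (Rmin (t - d1) (d2 - t)))
    (Rmin_l (s - e1) (e2 - s)) (Rmin_r (s - e1) (e2 - s))
    (Rmin_l (t - d1) (d2 - t)) (Rmin_r (t - d1) (d2 - t)).
  revert h1 h2; unfold Rabs; do 2 destruct Rcase_abs; intros; lra.
Qed.

(** * The first variation formula *)

Section FirstVariation.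
Variables (r : R) (hr : 0 < r) (X : E4) (eps del a b : R) (U V : R -> R -> R).
Hypotheses (heps : 0 < eps) (hdel : 0 < del) (hab : a < b).
Hypotheses (hU : smooth_strip eps del a b U) (hV : smooth_strip eps del a b V).
Hypothesis hpos : forall t, a <= t <= b ->
  0 < sqnorm r (U 0 t) (Derive (U 0) t) (Derive (V 0) t).

Let sn (s t : R) : R := sqnorm r (U s t) (Derive (U s) t) (Derive (V s) t).
Let f (s t : R) : R := lagr r X (U s t) (V s t) (Derive (U s) t) (Derive (V s) t).
Let df (s t : R) : R :=
  d_lagr r X (U s t) (V s t) (Derive (U s) t) (Derive (V s) t)
    (Derive (fun s => U s t) s) (Derive (fun s => V s t) s)
    (Derive (fun s => Derive (U s) t) s) (Derive (fun s => Derive (V s) t) s).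

Let in_strip (s t : R) : Prop := - eps < s < eps /\ a - del < t < b + del.

Let f_regular (s t : R) : in_strip s t -> 0 < sn s t ->
  is_derive (fun s => f s t) s (df s t) /\ continuity_2d_pt f s t
  /\ continuity_2d_pt df s t.
Proof.
  intros [hs ht] hst.
  destruct (ex_diff_2 _ _ _ (hU s t hs ht 2%nat))
    as (cU & Us & _ & cUs & cUt & _ & Uts & _ & cUts & _).
  destruct (ex_diff_2 _ _ _ (hV s t hs ht 2%nat))
    as (cV & Vs & _ & cVs & cVt & _ & Vts & _ & cVts & _).
  apply continuity_2d_pt_continuous in cU, cUs, cUt, cUts, cV, cVs, cVt, cVts.
  split; [|split].
  - apply (is_derive_lagr r hr X (fun s => U s t) (fun s => V s t)
      (fun s => Derive (U s) t) (fun s => Derive (V s) t)); trivial;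
      now apply Derive_correct.
  - apply continuity_2d_pt_continuous.
    apply (continuous_lagr r X (prod_UniformSpace R_UniformSpace R_UniformSpace) (s, t)
      (fun z => U (fst z) (snd z)) (fun z => V (fst z) (snd z))
      (fun z => Derive (U (fst z)) (snd z)) (fun z => Derive (V (fst z)) (snd z)));
      assumption.
  - apply continuity_2d_pt_continuous.
    apply (continuous_d_lagr r hr X (prod_UniformSpace R_UniformSpace R_UniformSpace) (s, t)
      (fun z => U (fst z) (snd z)) (fun z => V (fst z) (snd z))
      (fun z => Derive (U (fst z)) (snd z)) (fun z => Derive (V (fst z)) (snd z)));
      trivial; assumption.
Qed.

(** Regularity is assumed only of the central curve; by continuity it spreads to nearby parameters,
    where the square root is then differentiable. *)
Let sn_pos_locally (t : R) : a <= t <= b ->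
  locally_2d (fun s t => in_strip s t /\ 0 < sn s t) 0 t.
Proof.
  intros ht; apply locally_2d_and; [apply locally_2d_strip; lra|].
  assert (c : continuity_2d_pt sn 0 t).
  { destruct (ex_diff_2 U 0 t) as (cU & _ & _ & _ & cUt & _); [apply hU; lra|].
    destruct (ex_diff_2 V 0 t) as (cV & _ & _ & _ & cVt & _); [apply hV; lra|].
    apply continuity_2d_pt_continuous in cU, cUt, cV, cVt.
    apply continuity_2d_pt_continuous.
    apply (continuous_sqnorm r (prod_UniformSpace R_UniformSpace R_UniformSpace) (0, t)
      (fun z => U (fst z) (snd z))
      (fun z => Derive (U (fst z)) (snd z)) (fun z => Derive (V (fst z)) (snd z)));
      assumption. }
  (* The tolerance is the value [sn 0 t] itself, so a smaller deviation keeps [sn] positive. *)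
  destruct (c (mkposreal _ (hpos t ht))) as [d hd]; exists d; intros s t' h1 h2.
  generalize (hd s t' h1 h2); cbn; fold (sn 0 t); unfold Rabs; destruct Rcase_abs; lra.
Qed.

Let is_derive_RInt_f : is_derive (fun s => RInt (f s) a b) 0 (RInt (df 0) a b).
Proof.
  apply is_derive_RInt_param_compact; [lra|].
  intros t ht; split.
  - apply f_regular; [split; lra | now apply hpos].
  - destruct (sn_pos_locally t ht) as [d hd]; exists d; intros s t' h1 h2.
    destruct (hd s t' h1 h2) as [h3 h4]; destruct (f_regular s t' h3 h4); tauto.
Qed.

(** The derivative in [s] of the velocity is the derivative in [t] of the variation field, the form
    in which [is_derive_momentum] takes it. *)
Let Schwarz_strip (W : R -> R -> R) (t : R) :
  smooth_strip eps del a b W -> a <= t <= b ->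
  Derive (fun s => Derive (W s) t) 0 = Derive (fun t => Derive (fun s => W s t) 0) t.
Proof.
  intros hW ht; apply (Schwarz (fun s t => W s t)).
  - destruct (locally_2d_strip (- eps) eps (a - del) (b + del) 0 t) as [d hd]; try lra.
    exists d; intros s t' h1 h2; destruct (hd s t' h1 h2) as [h3 h4].
    destruct (ex_diff_2 _ _ _ (hW s t' h3 h4 2%nat))
     as (_ & Ws & Wt & _ & _ & Wst & Wts & _); tauto.
  - destruct (ex_diff_2 W 0 t) as (_ & _ & _ & _ & _ & _ & _ & _ & c & _); trivial.
    apply hW; lra.
  - destruct (ex_diff_2 W 0 t) as (_ & _ & _ & _ & _ & _ & _ & _ & _ & c & _); trivial.
    apply hW; lra.
Qed.

Lemma first_variation :
  (forall s, - eps < s < eps ->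
     U s a = U 0 a /\ V s a = V 0 a /\ U s b = U 0 b /\ V s b = V 0 b) ->
  is_derive (fun s => RInt (f s) a b) 0
    (RInt (fun t =>
       defect r X (U 0 t) (V 0 t) (Derive (U 0) t) (Derive (V 0) t)
         (Derive_n (U 0) 2 t) (Derive_n (V 0) 2 t)
       * cosh (U 0 t / r)
       * (Derive (U 0) t * Derive (fun s => V s t) 0
          - Derive (V 0) t * Derive (fun s => U s t) 0)) a b).
Proof.
  intros hend.
  set (g := fun t => _ * _ * (_ - _)).
  set (M := fun t => momentum r X (U 0 t) (V 0 t) (Derive (U 0) t) (Derive (V 0) t)
    (Derive (fun s => U s t) 0) (Derive (fun s => V s t) 0)).
  (* Fixed endpoints make the variation field, and hence the boundary term [M], vanish at [a] and
     [b]. *)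
  assert (hd0 : forall W : R -> R -> R, forall t,
    (forall s, - eps < s < eps -> W s t = W 0 t) -> Derive (fun s => W s t) 0 = 0).
  { intros W t hW; rewrite (Derive_ext_loc _ (fun _ => W 0 t)); [apply Derive_const|].
    exists (mkposreal eps heps); intros s hs; apply hW.
    change (Rabs (s - 0) < eps) in hs; revert hs; unfold Rabs; destruct Rcase_abs; lra. }
  assert (hM : M b - M a = 0).
  { unfold M, momentum; rewrite !hd0; [ring | intros; apply hend; assumption..]. }
  (* The strip extends beyond [a, b], so these facts, including the two-sided derivative of [M],
     hold at the endpoints as well. *)
  assert (hg : forall t, a <= t <= b -> continuous (df 0) t /\ continuous g t
     /\ is_derive M t (df 0 t - g t)).
  { intros t ht.
    assert (ht' : a - del < t < b + del) by lra.
    assert (h0 : - eps < 0 < eps) by lra.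
    destruct (ex_diff_2 _ _ _ (hU 0 t h0 ht' 2%nat))
      as (cU & Us & Ut & cUs & cUt & Ust & Uts & Utt & cUts & cUst & cUtt).
    destruct (ex_diff_2 _ _ _ (hV 0 t h0 ht' 2%nat))
      as (cV & Vs & Vt & cVs & cVt & Vst & Vts & Vtt & cVts & cVst & cVtt).
    apply continuity_2d_pt_snd in cU, cUs, cUt, cUtt, cV, cVs, cVt, cVtt.
    split; [|split].
    - apply continuity_2d_pt_snd, f_regular; [split; lra | now apply hpos].
    - generalize (continuous_defect r hr X R_UniformSpace t (U 0) (V 0) (Derive (U 0))
        (Derive (V 0)) cU cV cUt cVt (hpos t ht) _ _ cUtt cVtt); intros hK.
      unfold g, Rdiv; cbv beta in hK; solve_continuous.
    - unfold df; rewrite !Schwarz_strip by assumption.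
      apply (is_derive_momentum r hr X (U 0) (V 0) (Derive (U 0)) (Derive (V 0))
        (fun t => Derive (fun s => U s t) 0) (fun t => Derive (fun s => V s t) 0));
      try (now apply Derive_correct); now apply hpos. }
  assert (hmin : forall t, Rmin a b <= t <= Rmax a b -> a <= t <= b).
  { intros t; rewrite Rmin_left, Rmax_right; lra. }
  assert (hI : is_RInt (fun t => df 0 t - g t) a b (M b - M a)).
  { apply (is_RInt_derive (V := R_CompleteNormedModule) M);
      intros t ht%hmin; destruct (hg t ht) as (h1 & h2 & h3); [exact h3|].
    solve_continuous. }
  replace (RInt g a b) with (RInt (df 0) a b); [apply is_derive_RInt_f|].
  assert (e1 : ex_RInt (df 0) a b).
  { apply (ex_RInt_continuous (V := R_CompleteNormedModule)).
    intros t ht%hmin; apply (hg t ht). }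
  assert (e2 : ex_RInt g a b).
  { apply (ex_RInt_continuous (V := R_CompleteNormedModule)).
    intros t ht%hmin; apply (hg t ht). }
  apply (is_RInt_unique (V := R_CompleteNormedModule)) in hI.
  assert (hsub : RInt (fun t => df 0 t - g t) a b = RInt (df 0) a b - RInt g a b)
    by exact (RInt_minus (V := R_CompleteNormedModule) (df 0) g a b e1 e2).
  lra.
Qed.
End FirstVariation.

(** * Distance and side for the three planes *)

Lemma cosh_minus_sinh (x : R) : cosh x - sinh x = exp (- x).
Proof. unfold cosh, sinh; lra. Qed.

(** The products with the three fields are z, x and (x - y) / (r sqrt 2), the minus sign of the
    Lorentz form cancelling that of [killing] on x. In the parabolic case cosh - sinh produces the
    exponential. *)
Lemma dist_plane_eq (r : R) (P : ref_plane) (u v : R) : 0 < r ->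
  dist_plane r P u v = height r (killing r P) u v.
Proof.
  intros hr; assert (h2 := sqrt_lt_R0 2 ltac:(lra)).
  unfold height; rewrite psi_eq; destruct P; unfold lorentz, killing, dist_plane;
    cbn -[cosh sinh sqrt]; unfold mult, plus, opp; cbn -[cosh sinh sqrt]. all: try ring.
  replace (- v / r) with (- (v / r)) by (field; lra).
  rewrite <- cosh_minus_sinh; field; lra.
Qed.

Lemma on_side_psi (r : R) (P : ref_plane) (u v : R) : 0 < r ->
  (P = Elliptic -> 0 < u) -> on_side P (psi r u v).
Proof.
  intros hr hu; rewrite psi_eq; destruct P; cbn -[cosh sinh].
  - apply Rmult_lt_0_compat, sinh_gt_0, Rdiv_lt_0_compat; auto.
  - apply Rmult_lt_0_compat, Rmult_lt_0_compat; auto using cosh_gt_0.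
  - rewrite <- Rmult_minus_distr_l, <- Rmult_minus_distr_l, cosh_minus_sinh.
    apply Rmult_lt_0_compat, Rmult_lt_0_compat; auto using cosh_gt_0, exp_pos.
Qed.

Lemma dist_plane_gt_0 (r : R) (P : ref_plane) (u v : R) : 0 < r ->
  (P = Elliptic -> 0 < u) -> 0 < dist_plane r P u v.
Proof.
  intros hr hu; destruct P; unfold dist_plane.
  - apply Rmult_lt_0_compat, sinh_gt_0, Rdiv_lt_0_compat; auto.
  - apply Rmult_lt_0_compat; [apply Rmult_lt_0_compat|]; auto using cosh_gt_0.
  - apply Rmult_lt_0_compat; [apply Rmult_lt_0_compat|]; auto using cosh_gt_0, exp_pos.
    apply Rinv_0_lt_compat, sqrt_lt_R0; lra.
Qed.

(** * Smooth functions on an interval and affine families of them *)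

Lemma Derive_eq_itv (f g : R -> R) (a b t : R) : a < b -> a <= t <= b ->
  (forall t, a <= t <= b -> f t = g t) -> ex_derive f t -> ex_derive g t ->
  Derive f t = Derive g t.
Proof.
  intros hab ht hfg hf hg; apply Rminus_diag_uniq.
  rewrite <- Derive_minus by assumption.
  assert (hd : derivable_pt_lim (fun x => f x - g x) t (Derive (fun x => f x - g x) t)).
  { apply is_derive_Reals, Derive_correct; auto_derive; auto. }
  (* At an endpoint only one-sided difference quotients of [f - g] are known to vanish. They
     suffice, because the two-sided derivative [l] exists: with tolerance |l| a zero quotient gives
     |l| < |l|. *)
  set (l := Derive _ t) in hd |- *.
  destruct (Req_dec l 0) as [|hl]; [assumption|exfalso].
  destruct (hd (Rabs l)) as [d hd']; [now apply Rabs_pos_lt|].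
  (* The increment goes to the right, or to the left when [t] is [b], so as to stay in [a, b]. *)
  assert (step : exists h, h <> 0 /\ Rabs h < d /\ a <= t + h <= b).
  { generalize (cond_pos d); intros hd0.
    destruct (Rlt_dec t b) as [h|h].
    - exists (Rmin (d / 2) (b - t)).
      assert (0 < Rmin (d / 2) (b - t)) by (apply Rmin_glb_lt; lra).
      generalize (Rmin_l (d / 2) (b - t)) (Rmin_r (d / 2) (b - t)); intros.
      rewrite Rabs_pos_eq; lra.
    - exists (- Rmin (d / 2) (t - a)).
      assert (0 < Rmin (d / 2) (t - a)) by (apply Rmin_glb_lt; lra).
      generalize (Rmin_l (d / 2) (t - a)) (Rmin_r (d / 2) (t - a)); intros.
      rewrite Rabs_Ropp, Rabs_pos_eq; lra. }
  destruct step as (h & h0 & h1 & h2).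
  generalize (hd' h h0 h1); rewrite !hfg by lra.
  replace ((g (t + h) - g (t + h) - (g t - g t)) / h - l) with (- l) by (field; lra).
  rewrite Rabs_Ropp; lra.
Qed.

Lemma in_itv_locally (lo hi : Rbar) (t : R) :
  in_itv lo hi t -> locally t (in_itv lo hi).
Proof.
  intros [h1 h2]; apply filter_and.
  - exact (open_Rbar_gt' (Finite t) lo h1).
  - exact (open_Rbar_lt' (Finite t) hi h2).
Qed.

Lemma in_itv_between (lo hi : Rbar) (a b t : R) :
  in_itv lo hi a -> in_itv lo hi b -> a <= t <= b -> in_itv lo hi t.
Proof.
  intros [ha _] [_ hb] [h1 h2]; split.
  - eapply Rbar_lt_le_trans; [exact ha | exact h1].
  - eapply Rbar_le_lt_trans; [|exact hb]; exact h2.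
Qed.

Lemma smooth_on_Derive (lo hi : Rbar) (f : R -> R) :
  smooth_on lo hi f -> smooth_on lo hi (Derive f).
Proof.
  intros hf t ht [|n]; cbn; [exact I|].
  apply (ex_derive_ext (Derive_n f (S n))).
  - intros x; change (Derive f) with (Derive_n f 1).
    now rewrite Derive_n_comp, PeanoNat.Nat.add_1_r.
  - apply (hf t ht (S (S n))).
Qed.

Lemma smooth_on_ex_derive (lo hi : Rbar) (f : R -> R) (t : R) :
  smooth_on lo hi f -> in_itv lo hi t -> ex_derive f t.
Proof. intros hf ht; exact (hf t ht 1%nat). Qed.

Lemma smooth_on_continuous (lo hi : Rbar) (f : R -> R) (t : R) :
  smooth_on lo hi f -> in_itv lo hi t -> continuous f t.
Proof.
  intros hf ht; apply (ex_derive_continuous f).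
  now apply (smooth_on_ex_derive lo hi).
Qed.
(** It serves both for the factor (t - a)(b - t) of the test variation and, with zero coefficients,
    for the zero function. *)
Lemma smooth_on_quadratic (lo hi : Rbar) (c0 c1 c2 : R) :
  smooth_on lo hi (fun t => c0 + c1 * t + c2 * t ^ 2).
Proof.
  intros t _ n.
  assert (h1 : forall k t, ex_derive_n (fun t => c0 + c1 * t) k t).
  { intros k t'; apply ex_derive_n_plus; apply filter_forall; intros y j _.
    + apply ex_derive_n_const.
    + apply ex_derive_n_scal_l; apply (ex_derive_n_ext (fun t => t ^ 1)).
      * intros; ring.
      * apply ex_derive_n_pow. }
  apply (ex_derive_n_plus (fun t => c0 + c1 * t)); apply filter_forall; intros y j _.
  - apply h1.
  - apply ex_derive_n_scal_l, ex_derive_n_pow.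
Qed.

Lemma continuity_2d_pt_of_snd (f : R -> R) (s t : R) :
  continuous f t -> continuity_2d_pt (fun _ t => f t) s t.
Proof.
  intros hf; apply (continuity_1d_2d_pt_comp f (fun _ t => t)).
  - now apply continuity_pt_filterlim.
  - apply continuity_2d_pt_id2.
Qed.

(** Induction on the order works because functions g(t) + s h(t) are closed under both partial
    derivatives, which are h + s 0 and g' + s h'. *)
Lemma ex_diff_n_affine (lo hi : Rbar) (g h : R -> R) (n : nat) (s t : R) :
  smooth_on lo hi g -> smooth_on lo hi h -> in_itv lo hi t ->
  ex_diff_n (fun s t => g t + s * h t) n s t.
Proof.
  revert g h s t; induction n as [|n IHn]; intros g h s t hg hh ht.
  all: assert (c : continuity_2d_pt (fun s t => g t + s * h t) s t)
    by (apply continuity_2d_pt_plus, continuity_2d_pt_mult;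
        [ apply continuity_2d_pt_of_snd, (smooth_on_continuous lo hi); assumption
        | apply continuity_2d_pt_id1
        | apply continuity_2d_pt_of_snd, (smooth_on_continuous lo hi); assumption ]).
  - split; [exact c | exact I].
  - destruct (in_itv_locally _ _ _ ht) as [d hd].
    split; [exact c|]; split; [|split; [|split]].
    + auto_derive; exact I.
    + auto_derive; repeat split; now apply (smooth_on_ex_derive lo hi).
    (* The zero coefficient of [s] is written as a quadratic to fit the induction hypothesis. *)
    + apply (ex_diff_n_ext_loc (fun s t => h t + s * (0 + 0 * t + 0 * t ^ 2))).
      * exists d; intros s' t' _ _; symmetry; apply is_derive_unique.
        auto_derive; [exact I | ring].
      * apply IHn; trivial; apply smooth_on_quadratic.
    (* The derivative splits only where [g] and [h] are differentiable, hence the restriction to a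
       neighbourhood inside the interval. *)
    + apply (ex_diff_n_ext_loc (fun s t => Derive g t + s * Derive h t)).
      * exists d; intros s' t' _ h2; symmetry.
        specialize (hd t' h2).
        assert (eg := smooth_on_ex_derive _ _ _ _ hg hd).
        assert (eh := smooth_on_ex_derive _ _ _ _ hh hd).
        rewrite Derive_plus, Derive_scal; trivial; now apply ex_derive_scal.
      * apply IHn; trivial; now apply smooth_on_Derive.
Qed.

(** * Criticality and the curvature equation *)

Section Catenary.
Variables (r : R) (hr : 0 < r) (P : ref_plane) (lo hi : Rbar) (u v : R -> R).
Hypotheses (hu : smooth_on lo hi u) (hv : smooth_on lo hi v).
Hypothesis hreg : forall t, in_itv lo hi t -> velocity r u v t <> zero.

Let K (t : R) : R := defect r (killing r P) (u t) (v t) (Derive u t) (Derive v t)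
  (Derive_n u 2 t) (Derive_n v 2 t).

Let sn_pos (t : R) : in_itv lo hi t -> 0 < sqnorm r (u t) (Derive u t) (Derive v t).
Proof.
  intros ht; apply sqnorm_gt_0; trivial;
    [now apply (smooth_on_ex_derive lo hi)..|now apply hreg].
Qed.

(** The general formula involves [U 0] and [V 0], which agree with [u] and [v] only on [a, b]; the
    work lies in transferring the values and the first two derivatives. *)
Lemma first_variation_energy (a b eps : R) (U V : R -> R -> R) :
  in_itv lo hi a -> in_itv lo hi b -> a < b -> variation r P u v a b eps U V ->
  is_derive (fun s => energy r P a b (U s) (V s)) 0
    (RInt (fun t => K t * cosh (u t / r) *
       (Derive u t * Derive (fun s => V s t) 0
        - Derive v t * Derive (fun s => U s t) 0)) a b).
Proof.
  intros ha hb hab (heps & (del & hdel & hU & hV) & h0 & hend & _).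
  assert (hin : forall t, a <= t <= b -> in_itv lo hi t)
    by (intros t ht; now apply (in_itv_between lo hi a b)).
  assert (exU : forall s t, - eps < s < eps -> a <= t <= b ->
    ex_derive (U s) t /\ ex_derive (V s) t).
  { intros s t hs ht.
    destruct (hU s t hs ltac:(lra) 1%nat) as (_ & _ & eU & _).
    destruct (hV s t hs ltac:(lra) 1%nat) as (_ & _ & eV & _).
    split; [exact eU | exact eV]. }
  assert (hD : forall t, a <= t <= b ->
    Derive (U 0) t = Derive u t /\ Derive (V 0) t = Derive v t).
  { intros t ht; destruct (exU 0 t ltac:(lra) ht).
    split; apply (Derive_eq_itv _ _ a b); trivial;
      try (intros; now apply h0); now apply (smooth_on_ex_derive lo hi), hin. }
  apply (is_derive_ext_loc (fun s => RInt (fun t => lagr r (killing r P)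
    (U s t) (V s t) (Derive (U s) t) (Derive (V s) t)) a b)).
  { exists (mkposreal eps heps); intros s hs.
    change (Rabs (s - 0) < eps) in hs.
    assert (hs' : - eps < s < eps)
      by (revert hs; unfold Rabs; destruct Rcase_abs; lra).
    apply RInt_ext; rewrite Rmin_left, Rmax_right by lra; intros t ht.
    destruct (exU s t hs' ltac:(lra)).
    now rewrite dist_plane_eq, speed_eq. }
  rewrite (RInt_ext _ (fun t =>
       defect r (killing r P) (U 0 t) (V 0 t) (Derive (U 0) t) (Derive (V 0) t)
         (Derive_n (U 0) 2 t) (Derive_n (V 0) 2 t)
       * cosh (U 0 t / r)
       * (Derive (U 0) t * Derive (fun s => V s t) 0
          - Derive (V 0) t * Derive (fun s => U s t) 0))).
  - apply (first_variation r hr (killing r P) eps del a b U V); trivial.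
    + intros t ht; destruct (h0 t ht) as [-> _], (hD t ht) as [-> ->].
      now apply sn_pos, hin.
    + intros s hs; destruct (h0 a ltac:(lra)) as [-> ->], (h0 b ltac:(lra)) as [-> ->].
      now apply hend.
  - rewrite Rmin_left, Rmax_right by lra; intros t ht.
    (* The integrands are compared only at interior points, where agreement on a neighbourhood also
       identifies the second derivatives. *)
    assert (hloc : locally t (fun x => a <= x <= b)).
    { eapply filter_imp; [|apply (in_itv_locally (Finite a) (Finite b) t)].
      - intros x [h1 h2]; cbn in h1, h2; lra.
      - exact ht. }
    destruct (h0 t ltac:(lra)) as [eU eV], (hD t ltac:(lra)) as [dU dV].
    unfold K; rewrite eU, eV, dU, dV.
    rewrite (Derive_n_ext_loc (U 0) u 2 t), (Derive_n_ext_loc (V 0) v 2 t); trivial;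
      (eapply filter_imp; [|exact hloc]); intros; now apply h0.
Qed.

(** By [defect_eq], [K] is <n, X> + dist kappa, and the distance is positive, so dividing by it is
    an equivalence. *)
Lemma K_curvature (t : R) : in_itv lo hi t -> (P = Elliptic -> 0 < u t) ->
  curvature r u v t =
    - (lorentz (unit_normal r u v t) (killing r P) / dist_plane r P (u t) (v t))
  <-> K t = 0.
Proof.
  intros ht hside; unfold K; rewrite <- defect_eq, <- dist_plane_eq;
    try (now apply (smooth_on_ex_derive lo hi)); auto.
  generalize (dist_plane_gt_0 r P (u t) (v t) hr hside); intros hd.
  set (d := dist_plane _ _ _ _) in *; set (n := lorentz _ _).
  split; intros h.
  - rewrite h; field; lra.
  - apply (Rmult_eq_reg_l d); [|lra].
    replace (d * - (n / d)) with (- n) by (field; lra); lra.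
Qed.

Hypothesis hside : P = Elliptic -> forall t, in_itv lo hi t -> 0 < u t.

Lemma continuous_K (t : R) : in_itv lo hi t -> continuous K t.
Proof.
  intros ht.
  assert (hu1 := smooth_on_Derive _ _ _ hu).
  assert (hv1 := smooth_on_Derive _ _ _ hv).
  apply (continuous_defect r hr (killing r P) R_UniformSpace t u v (Derive u) (Derive v)
    (smooth_on_continuous _ _ _ _ hu ht) (smooth_on_continuous _ _ _ _ hv ht)
    (smooth_on_continuous _ _ _ _ hu1 ht) (smooth_on_continuous _ _ _ _ hv1 ht)
    (sn_pos t ht) (Derive_n u 2) (Derive_n v 2)).
  - exact (smooth_on_continuous _ _ _ _ (smooth_on_Derive _ _ _ hu1) ht).
  - exact (smooth_on_continuous _ _ _ _ (smooth_on_Derive _ _ _ hv1) ht).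
Qed.

(** The factor (t - a)(b - t) fixes the endpoints; [eps] only has to keep the curves on the right
    side of the plane. *)
Lemma quadratic_variation (a b al be : R) :
  in_itv lo hi a -> in_itv lo hi b -> a < b ->
  exists eps, variation r P u v a b eps
    (fun s t => u t + s * (al * ((t - a) * (b - t))))
    (fun s t => v t + s * (be * ((t - a) * (b - t)))).
Proof.
  intros ha hb hab.
  assert (smooth : forall c, smooth_on lo hi (fun t => c * ((t - a) * (b - t)))).
  { intros c t ht n.
    apply (ex_derive_n_ext
      (fun t => - (c * a * b) + c * (a + b) * t + - c * t ^ 2));
      [intros; ring | now apply (smooth_on_quadratic lo hi)]. }
  assert (aff : forall g c s t, smooth_on lo hi g -> in_itv lo hi t -> forall n,
    ex_diff_n (fun s t => g t + s * (c * ((t - a) * (b - t)))) n s t)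
    by (intros; now apply (ex_diff_n_affine lo hi)).
  assert (hin : forall t, a <= t <= b -> in_itv lo hi t)
    by (intros t ht; now apply (in_itv_between lo hi a b)).
  assert (hpos : locally 0 (fun s => forall t, a <= t <= b ->
    P = Elliptic -> 0 < u t + s * (al * ((t - a) * (b - t))))).
  { apply (locally_2d_compact (fun s t => _ -> _ < _)); intros t ht.
    destruct (classic (P = Elliptic)) as [hP|hP].
    - destruct (aff u al 0 t hu (hin t ht) 0%nat) as [c _].
      destruct (c (mkposreal _ (hside hP t (hin t ht)))) as [d hd].
      exists d; intros s t' h1 h2 _; generalize (hd s t' h1 h2); cbn.
      unfold Rabs; destruct Rcase_abs; lra.
    - exists (mkposreal 1 Rlt_0_1); intros; contradiction. }
  destruct hpos as [eps heps].
  destruct (in_itv_locally _ _ _ ha) as [da hda].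
  destruct (in_itv_locally _ _ _ hb) as [db hdb].
  generalize (cond_pos eps) (cond_pos da) (cond_pos db); intros he0 hda0 hdb0.
  exists eps; split; [exact he0|]; split; [|split; [|split]].
  (* The domain is open, so the strip can exceed [a, b] by the smaller of the two radii at its
     ends. *)
  - exists (Rmin da db); split; [now apply Rmin_glb_lt|].
    generalize (Rmin_l da db) (Rmin_r da db); intros hl hr'.
    assert (hin' : forall t, a - Rmin da db < t < b + Rmin da db -> in_itv lo hi t).
    { intros t ht; destruct (Rle_dec a t) as [h1|h1]; [destruct (Rle_dec t b) as [h2|h2]|].
      - apply hin; lra.
      - apply hdb; change (Rabs (t - b) < db); unfold Rabs; destruct Rcase_abs; lra.
      - apply hda; change (Rabs (t - a) < da); unfold Rabs; destruct Rcase_abs; lra. }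
    split; intros s t _ ht n; apply aff; auto.
  - intros t _; split; ring.
  - intros s _; repeat split; ring.
  - intros s t hs ht; apply on_side_psi; [exact hr|].
    apply heps; trivial; change (Rabs (s - 0) < eps).
    unfold Rabs; destruct Rcase_abs; lra.
Qed.

Lemma catenary_K (t0 : R) : extrinsic_catenary r P lo hi u v -> in_itv lo hi t0 -> K t0 = 0.
Proof.
  intros [_ hcrit] ht0.
  destruct (Req_dec (K t0) 0) as [|hK]; [assumption|exfalso].
  (* With this constant direction [H t0] is K(t0)^2 cosh(u/r) (u'^2 + v'^2), positive by
     regularity. *)
  set (al := - K t0 * Derive v t0); set (be := K t0 * Derive u t0).
  set (H := fun t => K t * cosh (u t / r) * (Derive u t * be - Derive v t * al)).
  assert (hH0 : 0 < H t0).
  { unfold H, al, be.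
    replace (_ * _ * _) with (K t0 ^ 2 * cosh (u t0 / r)
      * (Derive u t0 ^ 2 + Derive v t0 ^ 2)) by ring.
    apply Rmult_lt_0_compat; [apply Rmult_lt_0_compat|].
    - now apply pow2_gt_0.
    - apply cosh_gt_0.
    - generalize (sn_pos t0 ht0); unfold sqnorm; intros hsn.
      destruct (Req_dec (Derive u t0) 0) as [e|e]; [rewrite e in *|].
      + destruct (Req_dec (Derive v t0) 0) as [e'|e']; [rewrite e' in *; lra|].
        generalize (pow2_gt_0 _ e'); lra.
      + generalize (pow2_gt_0 _ e) (pow2_ge_0 (Derive v t0)); lra. }
  assert (cH : forall t, in_itv lo hi t -> continuous H t).
  { intros t ht; assert (h1 := continuous_K t ht).
    assert (h2 := smooth_on_continuous _ _ _ _ hu ht).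
    assert (h3 := smooth_on_continuous _ _ _ _ (smooth_on_Derive _ _ _ hu) ht).
    assert (h4 := smooth_on_continuous _ _ _ _ (smooth_on_Derive _ _ _ hv) ht).
    unfold H, Rdiv; solve_continuous. }
  assert (hloc : locally t0 (fun t => in_itv lo hi t /\ 0 < H t)).
  { apply filter_and; [now apply in_itv_locally|].
    apply (cH t0 ht0 (fun y => 0 < y)), (open_gt 0), hH0. }
  destruct hloc as [d hd]; generalize (cond_pos d); intros hd0.
  assert (hball : forall t, t0 - d / 2 <= t <= t0 + d / 2 -> in_itv lo hi t /\ 0 < H t).
  { intros t ht; apply hd; change (Rabs (t - t0) < d).
    unfold Rabs; destruct Rcase_abs; lra. }
  (* Half the radius puts the closed interval [a, b] inside the ball where [H] is positive. *)
  set (a := t0 - d / 2) in *; set (b := t0 + d / 2) in *.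
  assert (hab : a < b) by (unfold a, b; lra).
  assert (ha : in_itv lo hi a) by (apply hball; lra).
  assert (hb : in_itv lo hi b) by (apply hball; lra).
  destruct (quadratic_variation a b al be ha hb hab) as [eps hvar].
  (* Two values of the same derivative collide: zero by criticality, and a positive integral by the
     first variation formula. *)
  generalize (is_derive_unique _ _ _ (hcrit a b ha hb hab _ _ _ hvar)).
  rewrite (is_derive_unique _ _ _ (first_variation_energy a b _ _ _ ha hb hab hvar)).
  rewrite (RInt_ext _ (fun t => H t * ((t - a) * (b - t)))).
  - apply Rgt_not_eq, RInt_gt_0; [exact hab| |].
    + intros t ht; apply Rmult_lt_0_compat; [apply hball; lra | nra].
    + intros t ht; assert (h := cH t (proj1 (hball t ht))).
      assert (h' : continuous (fun t => (t - a) * (b - t)) t)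
        by (apply (ex_derive_continuous (V := R_NormedModule)); auto_derive; exact I).
      solve_continuous.
  - intros t _; unfold H.
    assert (e : forall c f, Derive (fun s => f t + s * (c * ((t - a) * (b - t)))) 0
      = c * ((t - a) * (b - t)))
      by (intros; apply is_derive_unique; auto_derive; [exact I | ring]).
    rewrite !e; apply Rminus_diag_uniq; ring.
Qed.
End Catenary.

Theorem theorem5 (r : R) (hr : 0 < r) (P : ref_plane)
    (lo hi : Rbar) (hI : Rbar_lt lo hi) (u v : R -> R)
    (hu : smooth_on lo hi u) (hv : smooth_on lo hi v)
    (hreg : forall t, in_itv lo hi t -> velocity r u v t <> zero)
    (hside : P = Elliptic -> forall t, in_itv lo hi t -> 0 < u t) :
  extrinsic_catenary r P lo hi u v <->
  (forall t, in_itv lo hi t ->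
     curvature r u v t =
     - (lorentz (unit_normal r u v t) (killing r P)
        / dist_plane r P (u t) (v t))).
Proof.
  split; intros H.
  - intros t ht; apply (K_curvature r hr P lo hi u v hu hv hreg t ht); auto.
    now apply (catenary_K r hr P lo hi).
  - split; [intros t ht; apply on_side_psi; auto|].
    intros a b ha hb hab eps U V hvar.
    evar_last; [now apply (first_variation_energy r hr P lo hi u v hu hv hreg a b eps)|].
    (* The curvature equation gives [K t = 0], so the first variation has zero integrand. *)
    rewrite (RInt_ext _ (fun _ => 0)).
    + rewrite RInt_const; apply Rmult_0_r.
    + rewrite Rmin_left, Rmax_right by lra; intros t ht.
      assert (hin : in_itv lo hi t) by (apply (in_itv_between lo hi a b); trivial; lra).
      rewrite (proj1 (K_curvature r hr P lo hi u v hu hv hreg t hin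
        (fun e => hside e t hin)) (H t hin)); apply Rminus_diag_uniq; ring.
Qed.
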